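(* Let $\mu$ be a compactly supported probability measure on $\mathbb{R}$, $\Lambda\sim\mu$, and $t\ge1$. Let $D_t\in\mathbb{R}^{t\times t}$ be a deterministic strictly lower triangular matrix and, for a deterministic lower triangular matrix $B_t\in\mathbb{R}^{t\times t}$, define $$P_t(\lambda):=(I_t-\lambda D_t+B_tD_t)^{-1}(\lambda I_t-B_t),\qquad\forall\lambda\in\mathbb{R}.$$ Then the following hold. (1) For any given $D_t$, the equation $\mathbb{E}[P_t(\Lambda)]=0_{t\times t}$ has a unique solution in the (lower triangular) matrix $B_t$. (2) The matrix $B_t$ solving $\mathbb{E}[P_t(\Lambda)]=0_{t\times t}$ can be represented as $$B_t=\sum_{i=1}^t\alpha_i D_t^{i-1}\qquad (D_t^0:=I_t),$$ where $\alpha_n:=\mathbb{E}[\Lambda Q_{n-1}(\Lambda)]$ for $n\ge1$, and $(Q_n)_{n\ge0}$ are the polynomials defined recursively by $Q_0(\lambda):=1$ and $$Q_n(\lambda)=\lambda Q_{n-1}(\lambda)-\sum_{i=1}^n\mathbb{E}[\Lambda Q_{i-1}(\Lambda)]\cdot Q_{n-i}(\lambda),\qquad\forall\lambda\in\mathbb{R},\ n\ge1.$$ (3) The matrix $B_t$ of (2) can alternatively be represented as $B_t=\sum_{i=1}^t\kappa_iD_t^{i-1}$, where $(\kappa_i)_{i\ge1}$ are the free cumulants of $\mu$. (4) With $B_t$ given as in (2), $P_t(\lambda)=\sum_{i=1}^tQ_i(\lambda)D_t^{i-1}$ for all $\lambda\in\mathbb{R}$.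
   Context: The free cumulants $(\kappa_k)_{k\ge1}$ of $\mu$, with moments $m_k=\int x^k\,\mu(dx)$, are the unique sequence with $m_k=\sum_{\pi\in \mathrm{NC}(k)}\prod_{B\in\pi}\kappa_{|B|}$ for all $k\ge1$, where $\mathrm{NC}(k)$ is the set of non-crossing partitions of $\{1,\dots,k\}$ (no $a<b<c<d$ with $a,c$ in one block and $b,d$ in a different block). Since $B_t$ is lower triangular and $D_t$ strictly lower triangular, $I_t-\lambda D_t+B_tD_t$ is lower triangular with unit diagonal, so the inverse exists. Expectation of a matrix is entrywise. *)

(* Defs.v *)
From HB Require Import structures.
From mathcomp Require Import all_boot all_order all_algebra.
From mathcomp Require Import all_classical all_reals all_analysis.

Set Implicit Arguments.
Unset Strict Implicit.
Unset Printing Implicit Defensive.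

Import Order.TTheory GRing.Theory Num.Theory.
Import numFieldNormedType.Exports.

Local Open Scope classical_set_scope.
Local Open Scope ring_scope.

(* Course-of-values recursion: [cvrec F n = F n [:: cvrec F 0; ...; cvrec F (n-1)]]. *)
Section CourseOfValues.
Variables (T : Type) (F : nat -> seq T -> T).

Fixpoint cvseq (n : nat) : seq T :=
  if n is m.+1 then rcons (cvseq m) (F m (cvseq m)) else [::].

Definition cvrec (n : nat) : T := F n (cvseq n).

Lemma cvrecE n : cvrec n = F n (mkseq cvrec n).
Proof.
rewrite {1}/cvrec; congr F; elim: n => //= n IHn.
by rewrite mkseqS -IHn.
Qed.

End CourseOfValues.

Section CompactSupport.
Variable R : realType.

Definition msupport (mu : probability (measurableTypeR R) R) : set R :=
  [set x | forall U : set R, open U -> U x -> (0 < mu U)%E].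

Definition compactly_supported (mu : probability (measurableTypeR R) R) : Prop :=
  compact (msupport mu).

End CompactSupport.

Section FreeCumulants.

(* The ground set {1, ..., k} is encoded, order-isomorphically, as 'I_k. *)
Definition noncrossing (k : nat) (p : {set {set 'I_k}}) : bool :=
  ~~ [exists A in p, exists B in p, (A != B) &&
      [exists a in A, exists b in B, exists c in A, exists d in B,
        [&& (a < b)%N, (b < c)%N & (c < d)%N]]].

Definition NC (k : nat) : {set {set {set 'I_k}}} :=
  [set p : {set {set 'I_k}} | finset.partition p [set: 'I_k]%SET &
     noncrossing p]%SET.

Variable R : realType.

Definition mmoment (mu : probability (measurableTypeR R) R) (k : nat) : R :=
  \int[mu]_x (x ^+ k).

(* The value [kappa 0] is unconstrained and irrelevant: blocks are nonempty. *)
Definition is_free_cumulants (mu : probability (measurableTypeR R) R)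
    (kappa : nat -> R) : Prop :=
  forall k : nat, (1 <= k)%N ->
    mmoment mu k = \sum_(p in NC k) \prod_(B in p) kappa #|B|.

End FreeCumulants.

Section MatrixExpectation.
Context d (Omega : measurableType d) (R : realType) (P : probability Omega R).

(* Extended-real entries, so that no integrability is presupposed. *)
Definition mxexpectation (m n : nat) (M : Omega -> 'M[R]_(m, n)) :
    'M[\bar R]_(m, n) :=
  \matrix_(i, j) 'E_P[fun w => M w i j]%E.

End MatrixExpectation.

Section Polynomials.
Context d (Omega : measurableType d) (R : realType) (P : probability Omega R).
Variable Lambda : {RV P >-> R}.

Definition EXq (q : {poly R}) : R :=
  fine 'E_P[fun w => (Lambda w * q.[Lambda w])%R]%E.

Definition Qpoly : nat -> {poly R} :=
  cvrec (fun n s =>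
    if n is m.+1 then
      'X * s`_m - \sum_(1 <= i < n.+1) EXq s`_i.-1 *: s`_(n - i)
    else 1).

Lemma Qpoly0 : Qpoly 0 = 1.
Proof. by rewrite /Qpoly cvrecE. Qed.

Lemma Qpoly_rec n : (1 <= n)%N ->
  Qpoly n = 'X * Qpoly n.-1 -
    \sum_(1 <= i < n.+1)
      fine 'E_P[fun w => (Lambda w * (Qpoly i.-1).[Lambda w])%R]%E *: Qpoly (n - i).
Proof.
case: n => // n _; rewrite {1}/Qpoly cvrecE -/Qpoly nth_mkseq //; congr (_ - _).
apply: eq_big_nat => -[|i] //; rewrite ltnS => /andP[_ le_in].
by rewrite !nth_mkseq // subSS ltnS leq_subr.
Qed.

Definition alpha (n : nat) : R := EXq (Qpoly n.-1).

End Polynomials.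

Section LowerTriangular.
Variable R : realType.

Definition strictly_lower (t : nat) (D : 'M[R]_t) : bool :=
  [forall i : 'I_t, forall j : 'I_t, (i <= j)%N ==> (D i j == 0)].

Definition Pmx (t : nat) (D B : 'M[R]_t) (lambda : R) : 'M[R]_t :=
  invmx (1%:M - lambda *: D + B *m D) *m (lambda%:M - B).

End LowerTriangular.

(* Every probability measure has a sequence of free cumulants in the above
   sense: the one-block partition isolates [kappa k] in the k-th relation. *)
Lemma free_cumulants_exist (R : realType)
    (mu : probability (measurableTypeR R) R) :
  exists kappa, is_free_cumulants mu kappa.
Proof.
pose one k : {set {set 'I_k}} := [set [set: 'I_k]]%SET.
pose F k s := mmoment mu k -
  \sum_(p in NC k | p != one k) \prod_(B in p) s`_#|B|.
have NCone k : (0 < k)%N -> one k \in NC k.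
  move=> k_gt0; rewrite finset.in_set; apply/andP; split.
    rewrite /finset.partition /finset.trivIset /finset.cover !big_set1 !eqxx.
    by rewrite finset.in_set1 eq_sym -card_gt0 cardsT card_ord k_gt0.
  apply/existsP => -[A /andP[/finset.set1P-> /existsP[B /andP[/finset.set1P-> ]]]].
  by rewrite eqxx.
exists (cvrec F) => k k_gt0; rewrite (bigD1 (one k)) ?NCone //=.
rewrite big_set1 cardsT card_ord {1}cvrecE /F.
apply/esym/eqP; rewrite -addrA eq_sym -subr_eq0 opprD addrA subrr sub0r.
rewrite oppr_eq0 addrC subr_eq0; apply/eqP/eq_bigr => p /andP[pNC pN1].
apply: eq_bigr => B Bp; rewrite nth_mkseq //.
have := max_card B; rewrite card_ord ltn_neqAle => ->; rewrite andbT.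
apply: contra_neqN pN1 => /eqP cardB.
move: pNC; rewrite finset.in_set => /andP[/and3P[_ /finset.trivIsetP tI p0] _].
have BT : B = [set: 'I_k]%SET.
  by apply/eqP; rewrite eqEcard finset.subsetT cardsT card_ord cardB leqnn.
apply/finset.setP => C; rewrite finset.in_set1; apply/idP/eqP => [Cp|->]; last by rewrite -BT.
case: (eqVneq C [set: 'I_k]%SET) => // CT.
have := tI C B Cp Bp; rewrite BT => /(_ CT).
rewrite -setI_eq0 finset.setIT => /eqP C0.
by rewrite C0 (negbTE p0) in Cp.
Qed.

(* Main.v *)
(* The resolvent [M = P_t(X)], a matrix of polynomials, is characterised by
   [M = (X - B) (1 + D M)].  If [E M = 0], this gives [B = E X + D E (X M)]; since
   [D] is strictly lower triangular, two solutions agreeing on their first [k]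
   rows agree on one more, so the solution is unique.  The recursion of the [Q_n]
   says that [S = sum_i Q_i D^(i-1)] satisfies the same equation with
   [B = sum_i alpha_i D^(i-1)] (here [D^t = 0]), and [E S = 0] because
   [E Q_n = 0] for [n >= 1].

   In the basis [Q_n], multiplication by [X] is the operator
   [Q_n |-> Q_(n+1) + sum_i alpha_i Q_(n+1-i)], and [E] reads off the coefficient
   of [Q_0]; hence [m_k] is the weighted count of Lukasiewicz paths of length [k].
   Scanning a non-crossing partition from left to right, going up at each point
   that is not the maximum of its block and down by [#|B| - 1] at the maximum of
   a block [B], puts NC(k) in bijection with these paths: a block being closed
   consists of its maximum and the topmost elements of the stack of pending
   points.  So the [alpha_i] are free cumulants. *)

Require Import Defs.
From HB Require Import structures.
From mathcomp Require Import all_boot all_order all_algebra.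
From mathcomp Require Import all_classical all_reals all_analysis.
From mathcomp Require Import measurable_realfun zify.

Import Order.TTheory GRing.Theory Num.Theory.
Import numFieldNormedType.Exports.

Set Implicit Arguments.
Unset Strict Implicit.
Unset Printing Implicit Defensive.


Local Open Scope ring_scope.

(** * Final segments of a set of points *)

Section UpperSets.
Context {n : nat}.
Implicit Types S U V : {set 'I_n}.

Definition upset S U : Prop :=
  U \subset S /\ forall x y, x \in U -> y \in S -> (x < y)%N -> y \in U.

(** Upper sets of [S] are nested: a point of [U] outside [V] lies below all of [V], which puts [V]
    inside [U]. Hence a block closed by the scan is determined by its size alone. *)
Lemma upset_card_inj S U V : upset S U -> upset S V -> #|U| = #|V| -> U = V.
Proof.
move=> [US Uup] [VS Vup] eqUV.
have [UV|/subsetPn[x xU xV]] := boolP (U \subset V).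
  by apply/eqP; rewrite eqEcard UV eqUV leqnn.
apply/esym/eqP; rewrite eqEcard eqUV leqnn andbT; apply/fintype.subsetP => v vV.
have [vx|xv|/val_inj vx] := ltngtP v x.
- by case/negP: xV; apply: Vup vV _ vx; exact: (fintype.subsetP US).
- by apply: Uup xU _ xv; exact: (fintype.subsetP VS).
- by rewrite -vx vV in xV.
Qed.

(** Start from [S] and delete the minimum [#|S| - k] times. *)
Lemma upset_exists S k : (k <= #|S|)%N -> exists2 U, upset S U & #|U| = k.
Proof.
move=> kS; rewrite -(subKn kS); elim: (#|S| - k)%N => [|e [U [US Uup] cU]].
  by rewrite subn0; exists S.
(* If [U] is already empty, truncated subtraction keeps the target size at zero. *)
have [U0|[x0 x0U]] := set_0Vmem U.
  by exists U => //; move: cU; rewrite U0 cards0; lia.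
pose x := [arg min_(x < x0 in U) (x : nat)]%N.
have [xU xmin] : x \in U /\ forall y, y \in U -> (x <= y)%N.
  by rewrite /x; case: arg_minnP.
exists (U :\ x)%SET; last by move: (cardsD1 x U); rewrite xU; lia.
split=> [|y z]; first exact: fintype.subset_trans (subD1set _ _) US.
rewrite !finset.in_setD1 => /andP[yx yU] zS yz; rewrite (Uup y)// andbT.
by apply: contraTneq yz => ->; rewrite -leqNgt xmin.
Qed.

End UpperSets.

Lemma noncrossingP {n : nat} (p : {set {set 'I_n}}) :
  reflect (forall A B, A \in p -> B \in p ->
             forall a b c d, a \in A -> b \in B -> c \in A -> d \in B ->
               (a < b)%N -> (b < c)%N -> (c < d)%N -> A = B)
          (noncrossing p).
Proof.
apply: (iffP idP) => [/negP ncp A B Ap Bp a b c d aA bB cA dB ab bc cd|ncp].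
  apply/eqP/negPn/negP => AB; apply: ncp.
  apply/existsP; exists A; rewrite Ap; apply/existsP; exists B; rewrite Bp AB.
  apply/existsP; exists a; rewrite aA; apply/existsP; exists b; rewrite bB.
  apply/existsP; exists c; rewrite cA; apply/existsP; exists d; rewrite dB.
  by rewrite ab bc cd.
apply/negP => /existsP[A /andP[Ap /existsP[B /andP[Bp /andP[/eqP AB]]]]].
move=> /existsP[a /andP[aA /existsP[b /andP[bB]]]].
move=> /existsP[c /andP[cA /existsP[d /andP[dB /and3P[ab bc cd]]]]].
exact/AB/(ncp A B Ap Bp a b c d).
Qed.

(** * Weighted Lukasiewicz paths *)

Section Lukasiewicz.
Variables (R : comNzRingType) (kappa : nat -> R).

(* Weight of the Lukasiewicz paths with [k] steps from height [h] down to [0]: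
   a step is either [+1], of weight [1], or [-j] with [0 <= j], of weight
   [kappa j.+1]. *)
Fixpoint luk (k h : nat) : R :=
  if k is k'.+1 then luk k' h.+1 + \sum_(j < h.+1) kappa j.+1 * luk k' (h - j)
  else (h == 0)%:R.

End Lukasiewicz.

Lemma eq_luk (R : comNzRingType) (kappa kappa' : nat -> R) :
  (forall j, kappa j.+1 = kappa' j.+1) -> luk kappa =2 luk kappa'.
Proof.
move=> eqk; elim=> [//|k IHk] h /=; rewrite IHk; congr (_ + _).
by apply: eq_bigr => j _; rewrite IHk eqk.
Qed.

(* The elements of [S] are the already visited points whose blocks still lack
   their maximum; the points [m, ..., n-1] have not been visited yet. *)
Definition NC_from (n m : nat) (S : {set 'I_n}) : {set {set {set 'I_n}}} :=
  [set p | [&& finset.partition p (S :|: [set x : 'I_n | m <= x]),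
               noncrossing p &
               [forall B in p, exists x in B, m <= x]]]%N%SET.

(** * Sums over non-crossing partitions by a left-to-right scan *)

Section NoncrossingSum.
Variables (R : comNzRingType) (kappa : nat -> R) (n : nat).
Implicit Types (S U : {set 'I_n}) (p : {set {set 'I_n}}).

Let weight p := \prod_(B in p) kappa #|B|.

Lemma NC_fromP m S p :
  reflect [/\ finset.partition p (S :|: [set x : 'I_n | m <= x]%N)%SET,
              noncrossing p &
              forall B, B \in p -> exists2 x, x \in B & (m <= x)%N]
          (p \in NC_from m S).
Proof.
rewrite finset.in_set; apply: (iffP and3P) => -[pT ncp bp]; split=> //.
  by move=> B Bp; move/forall_inP/(_ B Bp)/exists_inP : bp.
by apply/forall_inP => B Bp; apply/exists_inP; exact: bp.
Qed.

(** With no point left to visit, no block can reach [n], so only the empty partition remains, and it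
    requires [S] to be empty. *)
Lemma sum_NC_from_last S :
  \sum_(p in NC_from n S) weight p = (#|S| == 0)%:R.
Proof.
have mem0 p : p \in NC_from n S -> p = finset.set0.
  case/NC_fromP => _ _ bp; apply/finset.setP => B; rewrite finset.in_set0.
  by apply/negP => /bp[x _]; rewrite leqNgt ltn_ord.
have T0 : [set x : 'I_n | n <= x]%N%SET = finset.set0.
  by apply/finset.setP => x; rewrite !finset.in_set leqNgt ltn_ord.
rewrite cards_eq0; case: eqP => S0.
  rewrite (bigD1 finset.set0) /=; last first.
    apply/NC_fromP; split.
    - by rewrite S0 T0 finset.setU0 partition_set0.
    - by apply/noncrossingP => A B; rewrite finset.in_set0.
    - by move=> B; rewrite finset.in_set0.
  rewrite {1}/weight big_set0 big1 ?addr0// => p /andP[pS].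
  by rewrite (mem0 _ pS) eqxx.
rewrite big1// => p pS; case: S0.
have p0 := mem0 p pS; case/NC_fromP: pS => pT _ _.
by have := cover_partition pT; rewrite p0 T0 finset.setU0 /finset.cover big_set0.
Qed.

Section Step.
Variables (m : nat) (mn : (m < n)%N) (S : {set 'I_n}).
Hypothesis Sm : forall x, x \in S -> (x < m)%N.
Let i : 'I_n := Ordinal mn.
Let reaches p := [exists x in finset.pblock p i, m < x]%N.

Let groundE :
  (S :|: [set x : 'I_n | m <= x]%N = (i |: S) :|: [set x : 'I_n | m < x]%N)%SET.
Proof.
apply/finset.setP => x; rewrite !inE leq_eqVlt -val_eqE /= [m == x]eq_sym.
by case: (x \in S); rewrite ?orbT ?orbF.
Qed.

Let i_ground : i \in (S :|: [set x : 'I_n | m <= x]%N)%SET.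
Proof. by rewrite !inE /= leqnn orbT. Qed.

(** The up-step: [i] becomes pending. The ground set is the same on both sides, and only the block
    of [i] could reach [m] without reaching beyond it. *)
Lemma NC_from_reaches p :
  (p \in NC_from m S) && reaches p = (p \in NC_from m.+1 (i |: S)%SET).
Proof.
apply/andP/NC_fromP => [[/NC_fromP[pT ncp bp] /exists_inP[y yi my]]|[pT ncp bp]].
  split=> [|//|B Bp]; first by rewrite -groundE.
  have [x xB] := bp B Bp; rewrite leq_eqVlt => /orP[/eqP mx|]; last by exists x.
  have xi : x = i by apply: val_inj.
  exists y => //; rewrite -(def_pblock (partition_trivIset pT) Bp xB) xi//.
rewrite -groundE in pT; split.
  by apply/NC_fromP; split=> // B /bp[x xB /ltnW mx]; exists x.
have /bp[x xB mx] : finset.pblock p i \in p.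
  by rewrite pblock_mem// (cover_partition pT).
by apply/exists_inP; exists x.
Qed.

(** If [x < y] are pending and [x] is in the block of [i], then so is [y]: another block containing
    [y] would have to continue to some [z > m], and [x < y < i < z] would be a crossing. *)
Lemma pblock_closing p : p \in NC_from m S -> ~~ reaches p ->
  exists2 U, upset S U & finset.pblock p i = (i |: U)%SET.
Proof.
case/NC_fromP=> pT ncp bp /exists_inPn nr.
have ip : i \in finset.cover p by rewrite (cover_partition pT).
have Bp := pblock_mem ip; have iB : i \in finset.pblock p i by rewrite mem_pblock.
have BT := fintype.subsetP (partitionS pT Bp).
exists (finset.pblock p i :\ i)%SET; last by rewrite finset.setD1K.
split=> [|x y].
  apply/fintype.subsetP => x; rewrite finset.in_setD1 => /andP[xi xB].
  have := BT x xB; have := nr x xB; rewrite !inE -leqNgt => xm /orP[//|mx].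
  by case/eqP: xi; apply/val_inj/anti_leq; rewrite xm.
rewrite !finset.in_setD1 => /andP[xi xB] yS xy.
have ym := Sm yS; rewrite -val_eqE /= neq_ltn ym /=.
have yp : y \in finset.cover p by rewrite (cover_partition pT) inE yS.
have [z zC mz] := bp _ (pblock_mem yp).
have yC : y \in finset.pblock p y by rewrite mem_pblock.
have [mz'|zm] := ltnP m z.
  suff -> : finset.pblock p i = finset.pblock p y by [].
  by move/noncrossingP: ncp => /(_ _ _ Bp (pblock_mem yp) x y i z); exact.
have zi : z = i by apply/val_inj/anti_leq; rewrite zm.
by rewrite -zi (same_pblock (partition_trivIset pT) zC).
Qed.

(** Deleting and adding the block [i |: U] are inverse to each other; the left side has the shape
    produced by [reindex_onto]. *)
Lemma NC_from_closing U p : upset S U ->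
  [&& (i |: U)%SET |: p \in NC_from m S,
      finset.pblock ((i |: U) |: p)%SET i == (i |: U)%SET &
      (((i |: U) |: p) :\ (i |: U) == p)%SET] =
  (p \in NC_from m.+1 (S :\: U)%SET).
Proof.
move=> [US Uup]; set B := (i |: U)%SET.
have Um x : x \in U -> (x < m)%N by move=> /(fintype.subsetP US)/Sm.
have iS : i \notin S by apply/negP => /Sm; rewrite ltnn.
have groundD : ((S :|: [set x : 'I_n | m <= x]%N) :\: B =
    (S :\: U) :|: [set x : 'I_n | m < x]%N)%SET.
  rewrite groundE; apply/finset.setP => x; rewrite !inE -val_eqE /= negb_or.
  case: (ltngtP x m) => [xm|mx|/(@val_inj _ _ _ x i) ->].
  - by rewrite /= !orbF.
  - rewrite /= !orbT andbT; apply/negP => /Um; lia.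
  - by rewrite /= (negbTE iS) !andbF.
apply/and3P/NC_fromP => [[/NC_fromP[pT ncp bp] /eqP pB /eqP pD]|[pT ncp bp]].
  have Bp : B \in (B |: p)%SET by rewrite setU11.
  split.
  - by rewrite -groundD -pD; exact: partitionD1.
  - apply/noncrossingP => A C Ap Cp; move/noncrossingP: ncp; apply.
    + by rewrite finset.in_setU1 Ap orbT.
    + by rewrite finset.in_setU1 Cp orbT.
  - move=> A; rewrite -pD finset.in_setD1 => /andP[AB Ap].
    have [x xA] := bp A Ap; rewrite leq_eqVlt => /orP[/eqP mx|]; last by exists x.
    have xi : x = i by apply: val_inj.
    by case/eqP: AB; rewrite -pB -xi (def_pblock (partition_trivIset pT) Ap xA).
have disj : [disjoint B & (S :\: U) :|: [set x : 'I_n | m < x]%N]%SET.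
  rewrite -groundD -finset.setI_eq0; apply/eqP/finset.setP => x.
  by rewrite !inE; case: (_ || _).
have iB : i \in B by rewrite setU11.
have BS : (B \subset S :|: [set x : 'I_n | m <= x]%N)%SET.
  apply/fintype.subsetP => x.
  rewrite !inE => /orP[/eqP->|/(fintype.subsetP US)->//].
  by rewrite /= leqnn orbT.
have pT' : finset.partition (B |: p)%SET (S :|: [set x : 'I_n | m <= x]%N)%SET.
  suff -> : (S :|: [set x : 'I_n | m <= x]%N)%SET =
      (B :|: (S :\: U :|: [set x : 'I_n | m < x]%N))%SET.
    by apply: partitionU1 => //; apply/set0Pn; exists i.
  rewrite -groundD finset.setDE finset.setUIr finset.setUCr finset.setIT.
  exact/esym/finset.setUidPr.
have Bnp : B \notin p.
  apply/negP => /(partitionS pT)/fintype.subsetP/(_ i iB).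
  by apply/negP; rewrite (disjointFr disj iB).
have sep C b : C \in p -> b \in C -> (b <= m)%N -> b \in S /\ b \notin U.
  move=> /(partitionS pT)/fintype.subsetP CT /CT.
  rewrite !inE ltnNge => + bm; rewrite bm orbF => /andP[bU bS].
  by rewrite bS bU.
split.
- apply/NC_fromP; split=> //.
  + apply/noncrossingP => A C; rewrite !finset.in_setU1.
    move=> /orP[/eqP->|Ap] /orP[/eqP->|Cp]// a b c d aA bC cA dC ab bc cd.
    (* If the new block owns [a] and [c], then [b] is pending and lies above [a], an element of [U],
       so [b] would belong to [U]. The next case is the same with [b] and [c] in place of [a] and
       [b]. *)
    * have cm : (c <= m)%N.
        by move: cA; rewrite !inE => /orP[/eqP->//|/Um/ltnW].
      have [bS /negP[]] := sep C b Cp bC (leq_trans (ltnW bc) cm).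
      move: aA; rewrite !inE => /orP[/eqP ai|aU]; last exact: Uup aU bS ab.
      by have := leq_trans (ltn_trans ab bc) cm; rewrite ai ltnn.
    * have dm : (d <= m)%N.
        by move: dC; rewrite !inE => /orP[/eqP->//|/Um/ltnW].
      have [cS /negP[]] := sep A c Ap cA (leq_trans (ltnW cd) dm).
      move: bC; rewrite !inE => /orP[/eqP bi|bU]; last exact: Uup bU cS bc.
      by have := leq_trans (ltn_trans bc cd) dm; rewrite bi ltnn.
    * by move/noncrossingP: ncp => /(_ A C Ap Cp a b c d); exact.
  + move=> A; rewrite finset.in_setU1 => /orP[/eqP->|/bp[x xA /ltnW mx]].
      by exists i.
    by exists x.
- by rewrite (def_pblock (partition_trivIset pT') _ iB)// setU11.
- by rewrite setU1K.
Qed.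

Lemma sum_NC_from_closing U : upset S U ->
  \sum_(p in NC_from m S | finset.pblock p i == (i |: U)%SET) weight p =
  kappa #|U|.+1 * \sum_(p in NC_from m.+1 (S :\: U)%SET) weight p.
Proof.
move=> SU; set B := (i |: U)%SET.
have iU : i \notin U.
  by apply/negP => /(fintype.subsetP SU.1)/Sm; rewrite ltnn.
rewrite (reindex_onto (fun p => B |: p)%SET (fun p => p :\ B)%SET) /=; last first.
  move=> p /andP[/NC_fromP[pT _ _] /eqP pB]; rewrite finset.setD1K// -pB.
  by rewrite pblock_mem// (cover_partition pT).
rewrite mulr_sumr; apply: eq_big => [p|p /andP[_ /eqP pD]].
  by rewrite -andbA NC_from_closing.
rewrite /weight big_setU1 /= ?cardsU1 ?iU//.
by rewrite -pD finset.in_setD1 eqxx.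
Qed.

(** One unfolding of [luk]. Either [i] becomes pending, or it closes a block with the top [j]
    pending points; [upset_card_inj] makes [j] determine the block. *)
Lemma sum_NC_from_step (f : nat -> R) :
  (forall S', (forall x, x \in S' -> (x < m.+1)%N) ->
     \sum_(p in NC_from m.+1 S') weight p = f #|S'|) ->
  \sum_(p in NC_from m S) weight p =
  f #|S|.+1 + \sum_(j < #|S|.+1) kappa j.+1 * f (#|S| - j)%N.
Proof.
move=> fE; have iS : i \notin S by apply/negP => /Sm; rewrite ltnn.
rewrite (bigID reaches) /=; congr (_ + _).
  rewrite (eq_bigl _ _ NC_from_reaches) fE ?cardsU1 ?iS//.
  by move=> x; rewrite !inE => /orP[/eqP->//|/Sm/ltnW].
(* The default of [inord] never occurs here: a closed block has at most [#|S|] points besides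
   [i]. *)
rewrite (partition_big
  (fun p => inord #|finset.pblock p i|.-1 : 'I_(#|S|.+1)) xpredT)//=.
apply: eq_bigr => j _.
have [U SU Uj] : exists2 U, upset S U & #|U| = j.
  by apply: upset_exists; rewrite -ltnS.
have iU V : upset S V -> i \notin V.
  by move=> [VS _]; apply: contra iS; exact: (fintype.subsetP VS).
rewrite -Uj -cardsDS; last exact: SU.1.
rewrite -fE; last by move=> x; rewrite !inE => /andP[_ /Sm/ltnW].
rewrite -sum_NC_from_closing//; apply: eq_bigl => p.
rewrite -andbA; case: (boolP (p \in _)) => //= pS.
apply/andP/eqP => [[nr /eqP pj]|pB].
  have [V SV VE] := pblock_closing pS nr; rewrite VE; congr (i |: _)%SET.
  apply: (upset_card_inj SV SU); rewrite Uj -pj VE cardsU1 iU//= inordK//.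
  by rewrite ltnS subset_leq_card// SV.1.
split; last first.
  by rewrite pB cardsU1 iU//= Uj inord_val.
apply/exists_inPn => x; rewrite pB !inE -leqNgt => /orP[/eqP->//|].
by move/(fintype.subsetP SU.1)/Sm/ltnW.
Qed.

End Step.

Lemma sum_NC_from e m S : (m + e)%N = n -> (forall x, x \in S -> (x < m)%N) ->
  \sum_(p in NC_from m S) weight p = luk kappa e #|S|.
Proof.
elim: e m S => [|e IHe] m S men Sm.
  by rewrite addn0 in men; rewrite men; exact: sum_NC_from_last.
have mn : (m < n)%N by rewrite -men addnS ltnS leq_addr.
rewrite (sum_NC_from_step mn Sm (f := luk kappa e))//= => S'.
by apply: IHe; rewrite addSnnS.
Qed.

Lemma sum_NC : \sum_(p in NC n) weight p = luk kappa n 0.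
Proof.
rewrite -[0%N](cards0 'I_n) -(@sum_NC_from n 0)//; last by move=> x; rewrite inE.
apply: eq_bigl => p; rewrite !finset.in_set.
have -> : (finset.set0 :|: [set x : 'I_n | 0 <= x]%N = [set: 'I_n])%SET.
  by apply/finset.setP => x; rewrite !inE.
(* At [m = 0] the reaching condition only says that blocks are nonempty. *)
apply: andb_id2l => pT; rewrite andb_idr// => _.
apply/forall_inP => B /(partition_neq0 pT)/set0Pn[x xB].
by apply/exists_inP; exists x.
Qed.

End NoncrossingSum.

(** * Moments of a linear functional through the recursive polynomials *)

Section OrthogonalSystem.
Variables (R : comNzRingType) (L : {scalar {poly R}}) (Q : nat -> {poly R}).
Let a (j : nat) : R := L ('X * Q j).
Hypotheses (L1 : L 1 = 1) (Q0 : Q 0%N = 1)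
  (QS : forall n, Q n.+1 = 'X * Q n - \sum_(j < n.+1) a j *: Q (n - j)%N).

(** In the recursion the term [j = n] is [a n *: Q 0], whose value cancels [L ('X * Q n)]; the other
    terms vanish by induction. *)
Lemma functional_Q n : L (Q n) = (n == 0)%:R.
Proof.
elim/ltn_ind: n => -[|n] IHn; first by rewrite Q0 L1.
rewrite QS linearB linear_sum big_ord_recr /= subnn Q0 linearZ /= L1 mulr1.
rewrite big1 ?add0r ?subrr// => j _.
have nj : (n - j)%N == 0 = false by rewrite subn_eq0 leqNgt ltn_ord.
by rewrite linearZ /= IHn ?ltnS ?leq_subr// nj mulr0.
Qed.

(* Multiplication by the variable acts on the [Q n] by the steps of [luk]. *)
Lemma functional_XnQ k h :
  L ('X^k * Q h) = luk (fun j => a j.-1) k h.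
Proof.
elim: k h => [|k IHk] h; first by rewrite mul1r functional_Q.
have XQ : 'X * Q h = Q h.+1 + \sum_(j < h.+1) a j *: Q (h - j)%N.
  by rewrite QS subrK.
rewrite exprSr -mulrA XQ mulrDr mulr_sumr linearD linear_sum IHk /=.
by congr (_ + _); apply: eq_bigr => j _; rewrite -scalerAr linearZ /= IHk.
Qed.

Lemma functional_Xn k : L 'X^k = luk (fun j => a j.-1) k 0.
Proof. by rewrite -functional_XnQ Q0 mulr1. Qed.

End OrthogonalSystem.

(** * Power sums of a nilpotent element *)

Section Nilpotent.
Variables (K : comNzRingType) (A : algType K) (D : A) (t : nat).
Hypothesis Dt : D ^+ t = 0.

Lemma horner_alg_nilpotent (p : {poly K}) :
  horner_alg D p = \sum_(i < t) p`_i *: D ^+ i.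
Proof.
rewrite -{1}[p](poly_take_drop t) rmorphD rmorphM /= rmorphXn /= horner_algX Dt.
rewrite mulr0 addr0 /take_poly poly_def linear_sum /=.
by apply: eq_bigr => i _; rewrite linearZ /= rmorphXn /= horner_algX mulr_algl.
Qed.

(** Evaluation at [D] is a ring morphism, so this is the Cauchy product of polynomials, truncated by
    [Dt]. *)
Lemma mul_sum_nilpotent (a b : nat -> K) :
  (\sum_(i < t) a i *: D ^+ i) * (\sum_(i < t) b i *: D ^+ i) =
  \sum_(i < t) (\sum_(j < i.+1) a j * b (i - j)%N) *: D ^+ i.
Proof.
have hE (c : nat -> K) : \sum_(i < t) c i *: D ^+ i = horner_alg D (\poly_(i < t) c i).
  by rewrite horner_alg_nilpotent; apply: eq_bigr => i _; rewrite coef_poly ltn_ord.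
rewrite (hE a) (hE b) -rmorphM [LHS]horner_alg_nilpotent; apply: eq_bigr => i _.
rewrite coefM; congr (_ *: _); apply: eq_bigr => j _.
have jt : (j < t)%N by apply: leq_ltn_trans (ltn_ord i); rewrite -ltnS.
have ijt : (i - j < t)%N by apply: leq_ltn_trans (ltn_ord i); exact: leq_subr.
by rewrite !coef_poly jt ijt.
Qed.

(** Since [1 + D * S] is the generating sum of [q], the identity is the recursion read coefficient
    by coefficient. *)
Lemma sum_recurrence_fixpoint (x : K) (a q : nat -> K) :
  q 0%N = 1 ->
  (forall n, q n.+1 = x * q n - \sum_(j < n.+1) a j * q (n - j)%N) ->
  let S := \sum_(i < t) q i.+1 *: D ^+ i in
  S = (x%:A - \sum_(i < t) a i *: D ^+ i) * (1 + D * S).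
Proof.
move=> q0 qS S.
(* The extra term at index [t] vanishes with [D ^+ t]. *)
have -> : 1 + D * S = \sum_(i < t) q i *: D ^+ i.
  transitivity (\sum_(i < t.+1) q i *: D ^+ i).
    rewrite big_ord_recl /= q0 expr0 scale1r /S mulr_sumr; congr (_ + _).
    by apply: eq_bigr => i _; rewrite -scalerAr -exprS.
  by rewrite big_ord_recr /= Dt scaler0 addr0.
rewrite mulrBl mul_sum_nilpotent -scalerAl mul1r scaler_sumr -sumrB.
by apply: eq_bigr => i _; rewrite qS scalerBl scalerA.
Qed.

End Nilpotent.

(** * Triangular matrices and vanishing rows *)

Section LowerTriangularMatrices.
Variable (R : comNzRingType) (n : nat).
Implicit Types (A D M : 'M[R]_n.+1).

Definition is_strict_trig_mx D : Prop :=
  forall i j : 'I_n.+1, (i <= j)%N -> D i j = 0.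

Lemma strict_trig_mxX D k (i j : 'I_n.+1) :
  is_strict_trig_mx D -> (i < j + k)%N -> (D ^+ k) i j = 0.
Proof.
move=> Dl; elim: k i => [|k IHk] i ij.
  rewrite expr0 mxE; case: eqP => // eq_ij.
  by move: ij; rewrite eq_ij addn0 ltnn.
rewrite exprS mxE big1// => l _; have [il|li] := leqP i l; first by rewrite Dl ?mul0r.
by rewrite IHk ?mulr0//; move: ij; rewrite addnS ltnS; exact: leq_trans.
Qed.

Lemma strict_trig_mx_nilpotent D : is_strict_trig_mx D -> D ^+ n.+1 = 0.
Proof.
by move=> Dl; apply/matrixP => i j; rewrite mxE strict_trig_mxX// ltn_addl.
Qed.

Lemma sum_powers_is_trig D (c : nat -> R) m :
  is_strict_trig_mx D -> is_trig_mx (\sum_(i < m) c i *: D ^+ i).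
Proof.
move=> Dl; apply/is_trig_mxP => i j ij; rewrite summxE big1// => k _.
by rewrite mxE strict_trig_mxX ?mulr0// ltn_addr.
Qed.

(** The filtration behind uniqueness: a strictly lower triangular left factor gains a row, a lower
    triangular one loses none. *)
Definition rows_vanish k M : Prop := forall i j : 'I_n.+1, (i < k)%N -> M i j = 0.

Lemma rows_vanish_strict k D M :
  is_strict_trig_mx D -> rows_vanish k M -> rows_vanish k.+1 (D * M).
Proof.
move=> Dl Mk i j ik; rewrite mxE big1// => l _.
have [il|li] := leqP i l; first by rewrite Dl ?mul0r.
by rewrite Mk ?mulr0//; exact: leq_trans li _.
Qed.

Lemma rows_vanish_trig k A M :
  is_trig_mx A -> rows_vanish k M -> rows_vanish k (A * M).
Proof.
move=> /is_trig_mxP Al Mk i j ik; rewrite mxE big1// => l _.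
have [il|li] := ltnP i l; first by rewrite Al ?mul0r.
by rewrite Mk ?mulr0//; exact: leq_ltn_trans li ik.
Qed.

Lemma rows_vanish_mulr k A M : rows_vanish k M -> rows_vanish k (M * A).
Proof. by move=> Mk i j ik; rewrite mxE big1// => l _; rewrite Mk ?mul0r. Qed.

Lemma rows_vanishB k A M :
  rows_vanish k A -> rows_vanish k M -> rows_vanish k (A - M).
Proof. by move=> Ak Mk i j ik; rewrite !mxE Ak ?Mk ?subr0. Qed.

End LowerTriangularMatrices.

(** The determinant is 1, so this holds over any such ring; it serves both for real entries and for
    entries in [{poly R}]. *)
Lemma resolvent_unitmx (R : comUnitRingType) (n : nat) (B D : 'M[R]_n.+1) (x : R) :
  is_trig_mx B -> is_strict_trig_mx D -> 1%:M - x *: D + B *m D \in unitmx.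
Proof.
move=> Bl Dl.
have BDl (i j : 'I_n.+1) : (i <= j)%N -> (B *m D) i j = 0.
  move=> ij; rewrite mxE big1// => l _.
  have [il|li] := ltnP i l; first by rewrite (is_trig_mxP Bl) ?mul0r.
  by rewrite Dl ?mulr0//; exact: leq_trans li ij.
rewrite unitmxE det_trig; last first.
  apply/is_trig_mxP => i j ij; move: (BDl _ _ (ltnW ij)).
  rewrite !mxE (Dl _ _ (ltnW ij)) -val_eqE /= (ltn_eqF ij) => ->.
  by rewrite mulr0 subr0 addr0.
rewrite big1 ?unitr1// => i _; move: (BDl i i (leqnn _)).
by rewrite !mxE Dl// eqxx => ->; rewrite mulr0 subr0 addr0.
Qed.

(** Clearing the inverse gives an equation that ring morphisms and linear functionals can be applied
    to. *)
Lemma resolventP (K : comUnitRingType) (n : nat) (B D M : 'M[K]_n.+1) (x : K) :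
  is_trig_mx B -> is_strict_trig_mx D ->
  M = invmx (1%:M - x *: D + B *m D) *m (x%:M - B) <->
  M = (x%:M - B) *m (1%:M + D *m M).
Proof.
move=> Bl Dl; have U := resolvent_unitmx x Bl Dl.
have UE : (1%:M - x *: D + B *m D) *m M = M - (x%:M - B) *m (D *m M).
  rewrite mulmxDl mulmxBl mul1mx mulmxBl mul_scalar_mx opprB scalemxAl mulmxA.
  by rewrite addrA addrAC.
rewrite mulmxDr mulmx1; split=> ME.
  by apply/eqP; rewrite -subr_eq -UE ME mulKVmx.
by rewrite -[LHS](mulKmx U) UE; congr (_ *m _); apply/eqP; rewrite subr_eq -ME.
Qed.

(** * Uniqueness of the resolvent killed by a functional *)

Section VanishingResolvent.
Variables (R : fieldType) (L : {scalar {poly R}}) (n : nat).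
Implicit Types (A B D : 'M[R]_n.+1) (M : 'M[{poly R}]_n.+1).

Local Notation "A '^C'" := (map_mx polyC A).
Local Notation ev := (map_mx L).

Lemma functional_mulmxC A M : ev (A^C *m M) = A *m ev M.
Proof.
apply/matrixP => i j; rewrite !mxE linear_sum; apply: eq_bigr => l _.
by rewrite !mxE mul_polyC linearZ.
Qed.

Lemma is_trig_mapC A : is_trig_mx A -> is_trig_mx A^C.
Proof.
by move=> /is_trig_mxP Al; apply/is_trig_mxP => i j ij; rewrite mxE Al.
Qed.

Lemma is_strict_trig_mapC D : is_strict_trig_mx D -> is_strict_trig_mx D^C.
Proof. by move=> Dl i j ij; rewrite mxE Dl. Qed.

Lemma vanishing_resolvent_unique D B B' M M' : L 1 = 1 ->
  is_strict_trig_mx D -> is_trig_mx B -> is_trig_mx B' ->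
  M = ('X%:M - B^C) *m (1%:M + D^C *m M) -> ev M = 0 ->
  M' = ('X%:M - B'^C) *m (1%:M + D^C *m M') -> ev M' = 0 ->
  B = B' /\ M = M'.
Proof.
move=> L1 Dl Bl Bl' ME M0 ME' M0'.
(* Apply [L] entrywise to the equation; the term [A *m (D *m ev N)] drops out. *)
have BE A N : N = ('X%:M - A^C) *m (1%:M + D^C *m N) -> ev N = 0 ->
    A = (L 'X)%:M + D *m ev ('X *: N).
  move=> NE N0; have : ev N = 0 by [].
  rewrite {1}NE mulmxDr mulmx1 !mulmxBl mul_scalar_mx scalemxAr.
  have evB N1 N2 : ev (N1 - N2) = ev N1 - ev N2.
    by apply/matrixP => i j; rewrite !mxE linearB.
  have evD N1 N2 : ev (N1 + N2) = ev N1 + ev N2.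
    by apply/matrixP => i j; rewrite !mxE linearD.
  have evX : ev 'X%:M = (L 'X)%:M :> 'M[R]_n.+1.
    by apply/matrixP => i j; rewrite !mxE raddfMn.
  have evC : ev A^C = A.
    by apply/matrixP => i j; rewrite !mxE -alg_polyC linearZ /= L1 mulr1.
  rewrite evD !evB !functional_mulmxC evX evC N0 !mulmx0 subr0.
  by move/eqP; rewrite addrAC subr_eq0 => /eqP.
have dB : B - B' = D *m ev ('X *: (M - M')).
  rewrite (BE _ _ ME M0) (BE _ _ ME' M0') opprD addrACA subrr add0r -mulmxBr.
  by congr (_ *m _); apply/matrixP => i j; rewrite !mxE mulrBr linearB.
have dM : M - M' =
    ('X%:M - B'^C) *m (D^C *m (M - M')) - (B - B')^C *m (1%:M + D^C *m M).
  have -> : D^C *m (M - M') = (1%:M + D^C *m M) - (1%:M + D^C *m M').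
    by rewrite mulmxBr opprD addrACA subrr add0r.
  have -> : (B - B')^C = ('X%:M - B'^C) - ('X%:M - B^C).
    by rewrite map_mxB opprB [RHS]addrC addrA subrK.
  rewrite mulmxBr -ME' [(_ - ('X%:M - B^C)) *m _]mulmxBl -ME opprB.
  rewrite [in RHS](addrC M) [RHS]addrACA subrr add0r.
  exact: addrC.
(* Agreement of [k] rows of [M] and [M'] gives [k.+1] rows of [B] and [B'] by [dB], then [k.+1] rows
   of [M] and [M'] by [dM]. *)
have dM0 k : rows_vanish k (M - M').
  elim: k => [|k IHk]; first by move=> i j.
  have dB0 : rows_vanish k.+1 (B - B').
    rewrite dB; apply: rows_vanish_strict => // i j ik.
    by move: (IHk i j ik); rewrite !mxE => ->; rewrite mulr0 linear0.
  rewrite dM; apply: rows_vanishB.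
    apply: rows_vanish_trig.
      apply/is_trig_mxP => i j ij; rewrite !mxE (is_trig_mxP Bl')// subr0.
      by rewrite -val_eqE /= (ltn_eqF ij).
    by apply: rows_vanish_strict; first exact: is_strict_trig_mapC.
  apply: rows_vanish_mulr => i j ik.
  by move: (dB0 i j ik); rewrite !mxE => ->; rewrite polyC0.
have eqM : M = M'.
  apply/eqP; rewrite -subr_eq0; apply/eqP/matrixP => i j.
  by rewrite (dM0 n.+1) ?mxE.
split=> //; rewrite (BE _ _ ME M0) eqM; exact/esym/BE.
Qed.

End VanishingResolvent.

Local Open Scope classical_set_scope.

(** * From compact support to an almost sure bound *)

Section CompactSupport.
Variables (R : realType) (mu : probability (measurableTypeR R) R).

(* The complement of the support is covered by the null intervals with rational
   endpoints. *)
Lemma negligible_setC_msupport : mu.-negligible (~` msupport mu).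
Proof.
pose I (n : nat) : set R :=
  if @unpickle (rat * rat)%type n is Some q then `]ratr q.1, ratr q.2[ else set0.
pose F n := if mu (I n) == 0%E then I n else set0.
have mI n : measurable (I n).
  by rewrite /I; case: unpickle => [q|]; [exact: measurable_itv | exact: measurable0].
have : mu.-negligible (\bigcup_n F n).
  apply: negligible_bigcup => n; rewrite /F; case: eqP => [I0|_].
    by apply/negligibleP; first exact: mI.
  by apply/negligibleP; [exact: measurable0 | exact: measure0].
apply: negligibleS.
move=> x /= xS; have [U [oU Ux U0]] : exists U : set R, [/\ open U, U x & mu U = 0%E].
  apply: contrapT => noU; apply: xS => U oU Ux.
  rewrite lt0e measure_ge0 andbT; apply/eqP => U0; apply: noU.
  by exists U.
have [e /= e0 eU] := open_nbhs_nbhs (conj oU Ux).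
have xe : x - e < x by rewrite ltrBlDr ltrDl.
have ex : x < x + e by rewrite ltrDl.
have [p] := rat_in_itvoo xe; rewrite in_itv /= => /andP[xp px].
have [q] := rat_in_itvoo ex; rewrite in_itv /= => /andP[xq qx].
exists (pickle (p, q)) => //.
have pqU : I (pickle (p, q)) `<=` U.
  rewrite /I pickleK /= => y /=; rewrite in_itv /= => /andP[py yq]; apply: eU => /=.
  by rewrite /ball_ ltr_distlC (lt_trans xp py) (lt_trans yq qx).
have I0 : mu (I (pickle (p, q))) = 0%E.
  apply/eqP; rewrite eq_le measure_ge0 andbT -U0.
  apply: (le_measure mu _ _ pqU); apply/mem_set; first exact: mI.
  exact: open_measurable.
by rewrite /F I0 eqxx /I pickleK /= in_itv /= px xq.
Qed.

Lemma compactly_supported_bounded : compactly_supported mu ->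
  exists M : R, mu (~` `[- M, M]) = 0%E.
Proof.
(* Boundedness is known for every bound strictly above [M], hence [M + 1]. *)
move=> /compact_bounded[M [_ MS]]; exists (M + 1).
have mM : measurable (~` `[- (M + 1), M + 1] : set R).
  by apply: measurableC; exact: measurable_itv.
apply/negligibleP; first exact: mM.
apply: (negligibleS _ negligible_setC_msupport) => x /= + /(MS (M + 1)).
by rewrite ltrDl ltr01 in_itv /= ler_norml => + /(_ isT).
Qed.

End CompactSupport.

Lemma horner_bounded_itv (R : realType) (q : {poly R}) (M : R) :
  exists C : R, forall x, `[- M, M] x -> `|q.[x]| <= C.
Proof.
elim/poly_ind: q => [|q c [C qC]].
  by exists 0 => x _; rewrite horner0 normr0.
exists (`|C| * `|M| + `|c|) => x xM; rewrite hornerMXaddC.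
apply: le_trans (ler_normD _ _) _; rewrite lerD2r normrM ler_pM//.
  exact: le_trans (qC x xM) (ler_norm C).
by apply: le_trans (ler_norm M); move: xM; rewrite /= in_itv /= ler_norml.
Qed.

(** * Expectation as a linear functional on polynomials *)

Section PolynomialExpectation.
Context (R : realType) (mu : probability (measurableTypeR R) R)
  d (Omega : measurableType d) (P : probability Omega R) (Lambda : {RV P >-> R}).
Hypotheses (mu_compact : compactly_supported mu)
  (Lambda_mu : forall A : set R, measurable A -> distribution P Lambda A = mu A).

Lemma measurable_horner_RV (q : {poly R}) :
  measurable_fun setT (fun w => q.[Lambda w]).
Proof.
apply: (measurableT_comp (f := horner q)) => //.
by apply: continuous_measurable_fun; exact: continuous_horner.
Qed.

(** Off a null event [Lambda] stays in a bounded interval, on which [q] is bounded. *)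
Lemma integrable_horner_RV (q : {poly R}) :
  P.-integrable setT (EFin \o (fun w => q.[Lambda w])).
Proof.
have [M M0] := compactly_supported_bounded mu_compact.
have mM : measurable (~` `[- M, M] : set R) by apply: measurableC; exact: measurable_itv.
have mN : measurable (Lambda @^-1` (~` `[- M, M])).
  by rewrite -[X in measurable X]setTI; exact: measurable_funP.
apply/(negligible_integrable mN) => //.
- exact/measurable_EFinP/measurable_horner_RV.
- by apply: etrans M0; exact: Lambda_mu.
have [C qC] := horner_bounded_itv q M.
apply: measurable_bounded_integrable.
- exact: measurableD.
- by rewrite -ge0_fin_numE// fin_num_measure//; exact: measurableD.
- exact: measurable_funTS (measurable_horner_RV q).
- exists C; split; first exact: num_real.
  move=> K CK w /= [_ /contrapT wM]; exact: le_trans (qC _ wM) (ltW CK).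
Qed.

Definition Epoly (q : {poly R}) : R := fine 'E_P[fun w => q.[Lambda w]].

(** Integrability keeps [fine] away from its default value on infinities, so real and extended-real
    equations are interchangeable. *)
Lemma expectation_horner (q : {poly R}) :
  'E_P[fun w => q.[Lambda w]]%E = (Epoly q)%:E.
Proof.
rewrite /Epoly fineK// expectation_fin_num//.
exact/Lfun1_integrable/integrable_horner_RV.
Qed.

Fact Epoly_is_scalar : scalar Epoly.
Proof.
move=> c p q; apply: EFin_inj; rewrite EFinD EFinM -!expectation_horner.
have L1 r : (fun w => r.[Lambda w]) \in Lfun P 1.
  exact/Lfun1_integrable/integrable_horner_RV.
rewrite -expectationZl// -expectationD//; last first.
  rewrite (_ : _ \o* _ = (fun w => (c *: p).[Lambda w]))//.
  by apply/funext => w; rewrite /= hornerZ mulrC.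
by congr expectation; apply/funext => w /=; rewrite hornerD hornerZ mulrC.
Qed.

Lemma Epoly1 : Epoly 1 = 1.
Proof.
rewrite /Epoly (_ : (fun _ => _) = cst 1) ?expectation_cst//.
by apply/funext => w; rewrite hornerC.
Qed.

(** Change of variables along [Lambda], whose pushforward of [P] agrees with [mu]. *)
Lemma Epoly_Xn k : Epoly 'X^k = mmoment mu k.
Proof.
rewrite /mmoment /Rintegral /Epoly unlock; congr fine.
have mL : measurable_fun setT (Lambda : Omega -> measurableTypeR R).
  by move=> mT Y mY; exact: (@measurable_funP _ _ _ _ _ Lambda mT Y mY).
have mX : measurable_fun setT (fun x : measurableTypeR R => (x ^+ k)%:E).
  have mX : measurable_fun setT (fun x : R => (x ^+ k)%:E).
    by apply/measurable_EFinP; exact: exprn_measurable.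
  by move=> mT Y mY; exact: mX.
have XnE : (fun w => (('X^k : {poly R}).[Lambda w])%:E) =
    (fun x : measurableTypeR R => (x ^+ k)%:E) \o Lambda.
  by apply/funext => w; rewrite /= hornerXn.
rewrite (eq_measure_integral (pushforward P (Lambda : Omega -> measurableTypeR R)));
  last by move=> A mA _; apply: esym; exact: Lambda_mu.
rewrite (integral_pushforward mL mX) ?XnE//.
by rewrite -XnE; exact: integrable_horner_RV.
Qed.

End PolynomialExpectation.

(** * Uniqueness of the free cumulants *)

Lemma NC_block_card (k : nat) (p : {set {set 'I_k}}) (B : {set 'I_k}) :
  p \in NC k -> p != [set [set: 'I_k]]%SET -> B \in p -> (0 < #|B| < k)%N.
Proof.
rewrite finset.in_set => /andP[pT _] pN1 Bp.
rewrite card_gt0 (partition_neq0 pT Bp) /= ltn_neqAle -[X in (_ <= X)%N]card_ord.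
rewrite max_card andbT; apply: contraNneq pN1 => Bk.
have BT : B = [set: 'I_k]%SET.
  by apply/eqP; rewrite eqEcard finset.subsetT cardsT card_ord Bk leqnn.
have := partitionD1 pT Bp; rewrite BT finset.setDv partition_set0 -BT => /eqP p0.
by rewrite -(finset.setD1K Bp) p0 finset.setU0 BT.
Qed.

Lemma one_block_in_NC (k : nat) : (0 < k)%N -> [set [set: 'I_k]]%SET \in NC k.
Proof.
move=> k_gt0; rewrite finset.in_set; apply/andP; split.
  rewrite /finset.partition /finset.trivIset /finset.cover !big_set1 !eqxx.
  by rewrite finset.in_set1 eq_sym -card_gt0 cardsT card_ord k_gt0.
by apply/noncrossingP => A B /finset.set1P-> /finset.set1P->.
Qed.

(** In the [k]-th relation the one-block partition contributes exactly [kappa k], and every other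
    one involves only smaller positive indices, so strong induction applies. *)
Lemma free_cumulants_unique (R : realType)
    (mu : probability (measurableTypeR R) R) (kappa kappa' : nat -> R) :
  is_free_cumulants mu kappa -> is_free_cumulants mu kappa' ->
  forall k, (0 < k)%N -> kappa k = kappa' k.
Proof.
move=> kK kK'; elim/ltn_ind => k IHk k_gt0.
have := kK k k_gt0; rewrite (kK' k k_gt0).
rewrite !(bigD1 _ (one_block_in_NC k_gt0)) /= !big_set1 cardsT card_ord.
rewrite (eq_bigr (fun p : {set {set 'I_k}} => \prod_(B in p) kappa #|B|)).
  by move/addIr.
move=> p /andP[pNC pN1]; apply: eq_bigr => B Bp.
by have /andP[B0 Bk] := NC_block_card pNC pN1 Bp; rewrite IHk.
Qed.

(** * Evaluation of the polynomial resolvent, and the theorem *)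

Lemma Pmx_horner (R : realType) (n : nat) (D B : 'M[R]_n.+1) (M : 'M[{poly R}]_n.+1)
    (lambda : R) :
  is_strict_trig_mx D -> is_trig_mx B ->
  M = ('X%:M - map_mx polyC B) *m (1%:M + map_mx polyC D *m M) ->
  Pmx D B lambda = map_mx (horner_eval lambda) M.
Proof.
(* Evaluation at [lambda] is a ring morphism, so it carries the equation of [M] to the one
   characterising [Pmx]. *)
move=> Dl Bl ME; apply/esym/resolventP => //.
have mapC (A : 'M[R]_n.+1) : map_mx (horner_eval lambda) (map_mx polyC A) = A.
  by apply/matrixP => i j; rewrite !mxE /horner_eval hornerC.
rewrite {1}ME map_mxM map_mxB map_mxD map_mxM !mapC map_mx1 map_scalar_mx.
by rewrite /= /horner_eval hornerX.
Qed.

Theorem lemma2 (R : realType) (mu : probability (measurableTypeR R) R)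
  (mu_compact : compactly_supported mu)
  (d : measure_display) (Omega : measurableType d) (P : probability Omega R)
  (Lambda : {RV P >-> R})
  (Lambda_mu : forall A : set R, measurable A -> distribution P Lambda A = mu A)
  (t : nat) (t_ge1 : (1 <= t)%N)
  (D : 'M[R]_t) (D_lower : strictly_lower D) :
  let solves (B : 'M[R]_t) :=
    is_trig_mx B /\
    mxexpectation P (fun w => Pmx D B (Lambda w)) = const_mx 0%E in
  (exists! B : 'M[R]_t, solves B) /\
  (forall B : 'M[R]_t, solves B ->
    [/\ B = \sum_(1 <= i < t.+1) alpha Lambda i *: D ^+ i.-1,
        (forall kappa : nat -> R, is_free_cumulants mu kappa ->
          B = \sum_(1 <= i < t.+1) kappa i *: D ^+ i.-1)
      & forall lambda : R,
          Pmx D B lambda =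
          \sum_(1 <= i < t.+1) (Qpoly Lambda i).[lambda] *: D ^+ i.-1]).
Proof.
case: t t_ge1 D D_lower => // n _ D D_lower solves.
have Dl : is_strict_trig_mx D.
  by move=> i j ij; move/forallP: D_lower => /(_ i)/forallP/(_ j); rewrite ij => /eqP.
have sumS (V : nmodType) (F : nat -> V) :
    \sum_(1 <= i < n.+2) F i = \sum_(i < n.+1) F i.+1.
  by rewrite big_add1 big_mkord.
pose L : {scalar {poly R}} := HB.pack (Epoly Lambda)
  (GRing.isLinear.Build R {poly R} R _ _ (Epoly_is_scalar mu_compact Lambda_mu)).
have EE q : 'E_P[fun w => q.[Lambda w]]%E = (L q)%:E.
  exact: expectation_horner mu_compact Lambda_mu q.
have L1 : L 1 = 1 := Epoly1 Lambda.
pose Q := Qpoly Lambda; have Q0 : Q 0%N = 1 := Qpoly0 Lambda.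
have alphaE j : L ('X * Q j) = alpha Lambda j.+1.
  rewrite /alpha /EXq /L /= /Epoly; congr (fine (expectation _ _)).
  by apply/funext => w; rewrite hornerM hornerX.
have QS m : Q m.+1 = 'X * Q m - \sum_(j < m.+1) L ('X * Q j) *: Q (m - j)%N.
  rewrite /Q Qpoly_rec// big_add1 big_mkord; congr (_ - _).
  by apply: eq_bigr => j _; rewrite alphaE subSS.
(* Both sides are [luk] at height 0, with weights that agree at positive indices. *)
have alpha_cumulants : is_free_cumulants mu (alpha Lambda).
  move=> k k_gt0; rewrite sum_NC -(Epoly_Xn mu_compact Lambda_mu).
  rewrite [LHS](functional_Xn L1 Q0 QS); apply: eq_luk => j.
  exact: alphaE.
(* The solution and its polynomial resolvent, with summation indices shifted down by one. *)
pose B0 := \sum_(i < n.+1) alpha Lambda i.+1 *: D ^+ i.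
pose S := \sum_(i < n.+1) Q i.+1 *: map_mx polyC D ^+ i.
have B0l : is_trig_mx B0 by exact: (sum_powers_is_trig (fun i => alpha Lambda i.+1)).
have SE : S = ('X%:M - map_mx polyC B0) *m (1%:M + map_mx polyC D *m S).
  have Dt := strict_trig_mx_nilpotent (is_strict_trig_mapC Dl).
  rewrite {1}/S (sum_recurrence_fixpoint Dt (x := 'X)
    (a := fun j => (alpha Lambda j.+1)%:P) (q := Q))//; last first.
    move=> m; rewrite QS; congr (_ - _); apply: eq_bigr => j _.
    by rewrite alphaE mul_polyC.
  rewrite /= scalemx1; congr (('X%:M - _) * _).
  rewrite /B0 raddf_sum; apply: eq_bigr => i _.
  by rewrite /= map_mxZ rmorphXn.
have DX k : map_mx polyC D ^+ k = map_mx polyC (D ^+ k) by rewrite rmorphXn.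
(* Only [Q i] with [i >= 1] occur in [S], and [L] kills each of them. *)
have S0 : map_mx L S = 0.
  apply/matrixP => i j; rewrite !mxE summxE linear_sum big1// => k _.
  rewrite DX !mxE mulrC mul_polyC linearZ /=.
  by rewrite [X in _ * X](functional_Q L1 Q0 QS k.+1) mulr0.
have solvesE B M : is_trig_mx B ->
    M = ('X%:M - map_mx polyC B) *m (1%:M + map_mx polyC D *m M) ->
    mxexpectation P (fun w => Pmx D B (Lambda w)) = const_mx 0%E <->
    map_mx L M = 0.
  move=> Bl ME.
  have entryE i j : 'E_P[fun w => Pmx D B (Lambda w) i j]%E = (L (M i j))%:E.
    rewrite -EE; congr expectation; apply/funext => w.
    by rewrite (Pmx_horner _ Dl Bl ME) mxE.
  split=> /matrixP E0; apply/matrixP => i j; have := E0 i j; rewrite !mxE entryE.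
    exact: EFin_inj.
  by move=> ->.
have solB B : solves B -> B = B0 /\
    forall lambda, Pmx D B lambda = map_mx (horner_eval lambda) S.
  move=> [Bl EB].
  (* The inverse already exists over [{poly R}], so any solution has a polynomial resolvent to
     compare with [S]. *)
  have [M ME] : exists M, M = ('X%:M - map_mx polyC B) *m (1%:M + map_mx polyC D *m M).
    eexists; apply/resolventP; last by []; first exact: is_trig_mapC.
    exact: is_strict_trig_mapC.
  have M0 := (solvesE B M Bl ME).1 EB.
  have [eqB eqM] := vanishing_resolvent_unique L1 Dl Bl B0l ME M0 SE S0.
  by split=> // lambda; rewrite -eqM (Pmx_horner _ Dl Bl ME).
split.
  exists B0; split; first by split=> //; exact/(solvesE B0 S).
  by move=> B /solB[].
move=> B /solB[-> PB]; split.
- by rewrite sumS.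
- move=> kappa kappaP; rewrite sumS; apply: eq_bigr => i _; congr (_ *: _).
  exact: free_cumulants_unique alpha_cumulants kappaP _ _.
- move=> lambda; rewrite PB sumS /S raddf_sum; apply: eq_bigr => i _.
  by apply/matrixP => k l; rewrite DX !mxE /= /horner_eval hornerM hornerC.
Qed.
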